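(* Let $N$ and $k$ be positive integers. Then \[ \sum_{1\leq n_1\leq \cdots \leq n_{k}\leq N} \frac{1}{(n_1+N)n_2\cdots n_{k}} = \begin{cases} \displaystyle{\frac{1}{2}\sum_{1\leq m_1\leq\cdots\leq m_r\leq N} \frac{1}{m_1^2\cdots m_r^2}} &\text{if } k=2r,\\[2ex] \displaystyle{\sum_{1\leq n\leq 2m_1 \leq \cdots\leq 2m_r\leq 2N} \frac{(-1)^{n-1}}{nm_1^2\cdots m_r^2}} &\text{if } k=2r+1, \end{cases} \] all sums being over integers (for $k=1$, i.e. $r=0$, the second sum is $\sum_{n=1}^{2N}(-1)^{n-1}/n$). *)

(* Defs.v *)
From mathcomp Require Import all_boot all_order all_algebra.

Set Implicit Arguments.
Unset Strict Implicit.
Unset Printing Implicit Defensive.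

(* [chain s b] is 1 <= s_1 <= s_2 <= ... <= s_l <= b, for s = [:: s_1; ...; s_l]. *)
Definition chain (s : seq nat) (b : nat) : bool := path leq 1 (rcons s b).

(* Every summation variable is bounded by the last term of its chain, so ranging
   over ordinals (which include 0, excluded by [chain]) loses no index. *)

(* Main.v *)
(** Put [b_j(N) = \sum_(1 <= x <= N) z_j(x) / (x + N)], where [z_j(x)] is the sum
    of [1 / (n_1 ... n_j)] over [x <= n_1 <= ... <= n_j <= N].  Both sides of the
    identity satisfy the same recurrence in [N]: with [M = N + 1],
    [b_(j+2)(M) = b_(j+2)(N) + b_j(M) / M^2].  For the right-hand sides this is the
    splitting on whether the last variable equals [M].  For the left-hand side,
    splitting on the last variable gives [b_(j+1)(M) = c_(j+1) + b_j(M) / M], where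
    [c_j] has the weights [1 / (x + M)] but chains bounded by [N]; then
    [c_(j+1) + c_j / M - b_(j+1)(N)] telescopes. *)
Require Import Defs.
From mathcomp Require Import all_boot all_order all_algebra.
From mathcomp Require Import zify ring.
Set Implicit Arguments.
Unset Strict Implicit.
Unset Printing Implicit Defensive.
Import GRing.Theory Num.Theory.
Local Open Scope ring_scope.

(** With inverse integers as weights this is [z_j(a)]. For [j = 0] it is 1 even when [N < a],
    whereas longer chains starting beyond [N] give 0. *)
Fixpoint nested_sum {R : pzSemiRingType} (w : nat -> R) (N j a : nat) : R :=
  if j is i.+1 then \sum_(a <= x < N.+1) w x * nested_sum w N i x else 1.

Arguments nested_sum : simpl never.

Lemma nested_sum0 (R : pzSemiRingType) (w : nat -> R) N a :
  nested_sum w N 0 a = 1.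
Proof. by []. Qed.

Lemma nested_sumS (R : pzSemiRingType) (w : nat -> R) N j a :
  nested_sum w N j.+1 a = \sum_(a <= x < N.+1) w x * nested_sum w N j x.
Proof. by []. Qed.

Lemma nested_sum_front (R : pzSemiRingType) (w : nat -> R) N j a : (a <= N)%N ->
  nested_sum w N j.+1 a = w a * nested_sum w N j a + nested_sum w N j.+1 a.+1.
Proof. by move=> le_aN; rewrite !nested_sumS big_ltn. Qed.

Lemma nested_sum_out (R : pzSemiRingType) (w : nat -> R) N j a : (N < a)%N ->
  nested_sum w N j.+1 a = 0.
Proof. by move=> lt_Na; rewrite nested_sumS big_geq. Qed.

(** The largest variable either equals [N.+1] or stays below it; the recursion exposes only the
    smallest one, hence the induction on [j]. *)
Lemma nested_sum_last (R : comPzSemiRingType) (w : nat -> R) N j a :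
  (a <= N.+1)%N ->
  nested_sum w N.+1 j.+1 a =
    nested_sum w N j.+1 a + w N.+1 * nested_sum w N.+1 j a.
Proof.
elim: j a => [|j IHj] a le_aN.
  by rewrite !nested_sumS !nested_sum0 big_nat_recr.
rewrite nested_sumS big_nat_recr // IHj // nested_sum_out // add0r.
rewrite [nested_sum w N.+1 j.+1 a]nested_sumS [in RHS]big_nat_recr //=.
rewrite mulrDr addrA; congr (_ + _).
rewrite nested_sumS mulr_sumr -big_split /=.
apply: eq_big_nat => x /andP[_ lt_xN].
by rewrite IHj 1?ltnW // mulrDr [in RHS]mulrCA.
Qed.

Lemma big_tuple_cons (R : nmodType) (T : finType) n (P : pred (seq T))
    (F : seq T -> R) :
  \sum_(t : n.+1.-tuple T | P t) F t =
  \sum_(x : T) \sum_(t : n.-tuple T | P (x :: t)) F (x :: t).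
Proof.
rewrite pair_big_dep /=.
rewrite (reindex (fun p : T * n.-tuple T => [tuple of p.1 :: p.2])) //=.
exists (fun t => (thead t, [tuple of behead t])) => [[x t]|t] _ /=.
  by rewrite theadE; congr pair; apply: val_inj.
by rewrite -tuple_eta.
Qed.

(** For [r = 0] the path condition is [a <= N] itself, hence the hypothesis. *)
Lemma sum_chain_tuple (R : pzSemiRingType) (w : nat -> R) N r a : (a <= N)%N ->
  \sum_(t : r.-tuple 'I_N.+1 | path leq a (rcons [seq val i | i <- t] N))
    \prod_(i <- t) w (val i) = nested_sum w N r a.
Proof.
elim: r a => [|r IHr] a le_aN.
  rewrite (big_pred1 [tuple]) ?big_nil // => t.
  by rewrite tuple0 /= le_aN eqxx.
rewrite (big_tuple_cons _ (fun t => path leq a (rcons [seq val i | i <- t] N))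
  (fun t => \prod_(i <- t) w (val i))) nested_sumS big_geq_mkord [RHS]big_mkcond /=.
apply: eq_bigr => x _; case: leqP => _ /=; last by rewrite big_pred0.
rewrite -IHr -1?ltnS // mulr_sumr.
by apply: eq_bigr => t _; rewrite big_cons.
Qed.

(** [n <= 2 * i] means that [i] is at least the ceiling [uphalf n] of [n / 2], and [uphalf (2 * i)]
    is [i]. *)
Lemma path_leq_double n s N :
  path leq n (rcons [seq (2 * i)%N | i <- s] (2 * N)) =
  path leq (uphalf n) (rcons s N).
Proof.
have le_uphalf m i : (m <= 2 * i)%N = (uphalf m <= i)%N by lia.
elim: s n => [|i s IHs] n /=; first by rewrite !andbT.
by rewrite le_uphalf IHs; congr (_ && path _ _ _); lia.
Qed.

Section Recurrences.
Variable F : numFieldType.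

Let w1 (i : nat) : F := i%:R^-1.
Let w2 (i : nat) : F := i%:R^-2.

(** [b_j(N)], the left-hand side for [k = j.+1] with [n_1 = x] singled out. *)
Definition shifted_sum N j : F :=
  \sum_(1 <= x < N.+1) nested_sum w1 N j x / (x + N)%:R.

Definition alternating_sum N r : F :=
  \sum_(1 <= n < (2 * N).+1)
    (-1) ^+ n.-1 / n%:R * nested_sum w2 N r (uphalf n).

(** [c_j]. The term [x = N.+1] lies beyond the chain bound and survives only for [j = 0], as
    [1 / (2 * N.+1)]. *)
Let mid_sum N j : F :=
  \sum_(1 <= x < N.+2) nested_sum w1 N j x / (x + N.+1)%:R.

Let shifted_mid0 N : shifted_sum N.+1 0 = mid_sum N 0.
Proof. by []. Qed.

Let shifted_midS N j :
  shifted_sum N.+1 j.+1 = mid_sum N j.+1 + shifted_sum N.+1 j / N.+1%:R.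
Proof.
rewrite /shifted_sum mulr_suml -big_split /=.
apply: eq_big_nat => x /andP[_ lt_xN].
by rewrite nested_sum_last // mulrDl [w1 _ * _]mulrC mulrAC.
Qed.

Let mid_sum_telescope N j :
  mid_sum N j.+1 + mid_sum N j / N.+1%:R - shifted_sum N j.+1 =
    (j == 0)%:R / (2 * N.+1%:R ^+ 2).
Proof.
(* [x z_(j+1)(x) - z_j(x) = x z_(j+1)(x+1)] makes each summand [T (x+1) - T x]. *)
pose T x := - (nested_sum w1 N j.+1 x * (x.-1)%:R / (x.-1 + N.+1)%:R / N.+1%:R).
have -> : mid_sum N j.+1 + mid_sum N j / N.+1%:R - shifted_sum N j.+1 =
    \sum_(1 <= x < N.+1) (T x.+1 - T x) + (j == 0)%:R / (2 * N.+1%:R ^+ 2).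
  (* The terms [x = N.+1] are split off; divided by [N.+1], the one of [c_0] is the correction for
     [j = 0]. *)
  rewrite /mid_sum !(@big_nat_recr _ _ _ N.+1) //= nested_sum_out // mul0r addr0.
  rewrite mulrDl addrA [LHS]addrAC mulr_suml -big_split -sumrB /=; congr (_ + _).
    apply: eq_big_nat => -[//|x] /andP[_ lt_xN].
    rewrite /T (@nested_sum_front F w1 N j x.+1 lt_xN) /w1 /=.
    rewrite !addSn !addnS -!natr1 natrD.
    have ? : x%:R + N%:R + 1 + 1 != 0 :> F by rewrite -natrD !natr1 pnatr_eq0.
    have ? : x%:R + N%:R + 1 != 0 :> F by rewrite -natrD !natr1 pnatr_eq0.
    have ? : x%:R + 1 != 0 :> F by rewrite !natr1 pnatr_eq0.
    have ? : N%:R + 1 != 0 :> F by rewrite !natr1 pnatr_eq0.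
    by field; do ?[apply/andP; split].
  rewrite addnn -mul2n natrM; case: (j) => [|i] /=.
    by rewrite nested_sum0; field; rewrite addrC natr1 pnatr_eq0.
  by rewrite nested_sum_out // !mul0r.
(* [T 1] vanishes through the factor [x.-1], and [T N.+1] because no nonempty chain starts beyond
   [N]. *)
rewrite telescope_sumr // /T nested_sum_out //= mulr0 !mul0r oppr0 subr0.
by rewrite add0r.
Qed.

(** The window [N < i <= 2 * N] of the sum of [1 / i] moves: it gains two terms at the top and loses
    [1 / N.+1], which is [2 / (2 * N).+2]. *)
Lemma shifted_sum0 N :
  shifted_sum N.+1 0 =
    shifted_sum N 0 + ((2 * N).+1%:R^-1 - (2 * N).+2%:R^-1).
Proof.
pose g x : F := (x + N)%:R^-1.
have -> : shifted_sum N 0 = \sum_(1 <= x < N.+1) g x.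
  by apply: eq_bigr => x _; rewrite nested_sum0 mul1r.
have -> : shifted_sum N.+1 0 = \sum_(1 <= x < N.+2) g x.+1.
  by apply: eq_bigr => x _; rewrite nested_sum0 mul1r /g addnS.
apply: (addrI (g 1%N)); rewrite -big_nat_recl // 2?big_nat_recr //=.
rewrite [RHS]addrCA -[LHS]addrA; congr (_ + _).
rewrite /g !addSn addnn -mul2n add0n [RHS]addrCA; congr (_ + _).
have -> : (2 * N).+2%:R = 2 * N.+1%:R :> F by rewrite -natrM mulnS.
by field; rewrite addrC natr1 pnatr_eq0.
Qed.

(** Here the correction of [mid_sum_telescope] is nonzero; it is the source of the factor 1/2 for
    even [k]. *)
Lemma shifted_sum1 N :
  shifted_sum N.+1 1 = shifted_sum N 1 + 2^-1 * w2 N.+1.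
Proof.
have := mid_sum_telescope N 0.
rewrite shifted_midS shifted_mid0 => /eqP.
rewrite subr_eq => /eqP ->; rewrite addrC /w2 mul1r; congr (_ + _).
by rewrite invfM.
Qed.

Lemma shifted_sumSS N j :
  shifted_sum N.+1 j.+2 = shifted_sum N j.+2 + w2 N.+1 * shifted_sum N.+1 j.
Proof.
have /eqP := mid_sum_telescope N j.+1.
rewrite mul0r subr_eq0 => /eqP <-.
rewrite 2!shifted_midS /w2 mulrDl addrA; congr (_ + _).
by rewrite -mulrA -invfM -expr2 mulrC.
Qed.

Lemma alternating_sum0 N :
  alternating_sum N.+1 0 =
    alternating_sum N 0 + ((2 * N).+1%:R^-1 - (2 * N).+2%:R^-1).
Proof.
rewrite /alternating_sum mulnS !addSn add0n 2?big_nat_recr //= !nested_sum0 !mulr1 -addrA.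
by rewrite exprS -signr_odd oddM expr0 mulr1 mul1r mulN1r.
Qed.

Lemma alternating_sumS N r :
  alternating_sum N.+1 r.+1 =
    alternating_sum N r.+1 + w2 N.+1 * alternating_sum N.+1 r.
Proof.
(* The two added indices have [uphalf n = N.+1], so their inner sums vanish. *)
have -> : alternating_sum N r.+1 =
    \sum_(1 <= n < (2 * N.+1).+1)
      (-1) ^+ n.-1 / n%:R * nested_sum w2 N r.+1 (uphalf n).
  rewrite mulnS !addSn add0n [RHS]big_nat_recr // [in RHS]big_nat_recr //=.
  by rewrite !nested_sum_out ?mulr0 ?addr0 //; lia.
rewrite mulr_sumr -big_split; apply: eq_big_nat => n /andP[_ lt_nN].
by rewrite nested_sum_last ?mulrDr 1?[in RHS]mulrCA //; lia.
Qed.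

(** Both sides vanish at [N = 0] and obey the same recurrence; it also involves smaller [r] at
    [N.+1], hence the inner induction. *)
Lemma shifted_sum_odd N r :
  shifted_sum N (2 * r).+1 = 2^-1 * nested_sum w2 N r.+1 1.
Proof.
elim: N r => [|N IHN] r.
  by rewrite nested_sum_out // mulr0 /shifted_sum big_geq.
elim: r => [|r IHr].
  by rewrite shifted_sum1 (IHN 0) nested_sum_last // nested_sum0 mulr1 mulrDr.
have := IHN r.+1; rewrite mulnS !addSn add0n shifted_sumSS IHr => ->.
by rewrite [in RHS]nested_sum_last // mulrDr mulrCA.
Qed.

Lemma shifted_sum_even N r : shifted_sum N (2 * r) = alternating_sum N r.
Proof.
elim: N r => [|N IHN] r; first by rewrite /shifted_sum /alternating_sum !big_geq.
elim: r => [|r IHr]; first by rewrite shifted_sum0 (IHN 0) alternating_sum0.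
have := IHN r.+1; rewrite mulnS !addSn add0n shifted_sumSS IHr => ->.
by rewrite alternating_sumS.
Qed.

End Recurrences.

Theorem theorem7p1 (N k : nat) (hN : (0 < N)%N) (hk : (0 < k)%N) :
  let lhs : rat :=
    \sum_(n : k.-tuple 'I_N.+1 | chain [seq val i | i <- n] N)
      1 / ((head ord0 n + N)%:R * \prod_(i <- behead n) (val i)%:R) in
  (forall r : nat, k = (2 * r)%N ->
     lhs = 1 / 2 *
       \sum_(m : r.-tuple 'I_N.+1 | chain [seq val i | i <- m] N)
         1 / \prod_(i <- m) (val i)%:R ^+ 2) /\
  (forall r : nat, k = (2 * r + 1)%N ->
     lhs =
       \sum_(n < (2 * N).+1)
         \sum_(m : r.-tuple 'I_N.+1 |
                 chain (val n :: [seq (2 * val i)%N | i <- m]) (2 * N))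
           (-1) ^+ n.-1 / ((val n)%:R * \prod_(i <- m) (val i)%:R ^+ 2)).
Proof.
case: k hk => // k _ lhs.
have lhsE : lhs = shifted_sum rat N k.
  rewrite /lhs (big_tuple_cons _ (fun t => chain [seq val i | i <- t] N)
    (fun t => 1 / ((head ord0 t + N)%:R * \prod_(i <- behead t) (val i)%:R))).
  rewrite /shifted_sum big_geq_mkord [RHS]big_mkcond /=.
  apply: eq_bigr => x _; rewrite /chain /=.
  case: (0 < x)%N => /=; last by rewrite big_pred0.
  rewrite -sum_chain_tuple -1?ltnS // mulr_suml.
  by apply: eq_bigr => t _; rewrite mul1r invfM prodfV mulrC.
split=> r.
  (* As [k] now counts the variables after [n_1], even length means odd index; [r = 0] is excluded
     by positivity. *)
  case: r => // r; rewrite mulnS => -[k_eq].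
  rewrite lhsE k_eq shifted_sum_odd mul1r -sum_chain_tuple //.
  by congr (_ * _); apply: eq_bigr => t _; rewrite mul1r prodfV.
rewrite addn1 => -[k_eq]; rewrite lhsE k_eq shifted_sum_even.
rewrite /alternating_sum big_geq_mkord [LHS]big_mkcond /=.
apply: eq_bigr => n _; under [RHS]eq_bigl => t.
  rewrite /chain /= (map_comp (muln 2) val) path_leq_double; over.
(* The index [n = 0] admits no chain; for the others, [n <= 2 * N] gives [uphalf n <= N]. *)
case: (0 < n)%N => /=; last by rewrite big_pred0.
rewrite -sum_chain_tuple; last by have := ltn_ord n; lia.
rewrite mulr_sumr; apply: eq_bigr => t _.
by rewrite invfM mulrA prodfV.
Qed.
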